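(* Let $H$ be a colour Hopf algebra, $A$ a colour-commutative graded $H$-comodule colour algebra, $B=A^{coH}$ and $M$ a colour $(A,H)$-Hopf module. Assume that there is a graded $H$-colinear map $\theta:H\to A$ which is a homomorphism of colour algebras and that the bicharacter is symmetric. Let $p_M:M\to M$, $p_M(m)=\theta(\mathcal S_H(m_{(-1)}))m_{(0)}$, and for $a\in A$ and $m\in M$ set $a\rightharpoonup m=p_M(am)$. Then: (1) $a\rightharpoonup p_M(m)=p_M(am)=a\rightharpoonup m$ for all $a\in A$, $m\in M$; (2) $M^{coH}$ is a graded left $A$-module, with action $a\rightharpoonup m=p_M(am)$ for all $a\in A$ and $m\in M^{coH}$. In particular, $A^{coH}$ is a graded left $A$-module under the $A$-action $a'\rightharpoonup a=p_A(a'a)$ for all $a'\in A$ and $a\in A^{coH}$.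
   Context: $\Bbbk$ is a field and $G$ is a multiplicative abelian group with identity $e$ and a bicharacter $(\cdot/\cdot):G\times G\to\Bbbk^{\times}$, i.e. $(g/g'g'')=(g/g')(g/g'')$ and $(gg'/g'')=(g/g'')(g'/g'')$. The bicharacter is symmetric if $(g/g')(g'/g)=1$ for all $g,g'$. ''Graded'' means $G$-graded; $|m|$ is the degree of a homogeneous element $m$; formulas are written for homogeneous elements and extended linearly. A graded map $f:M\to N$ is a $\Bbbk$-linear map with $f(M_g)\subseteq N_g$ for all $g$. $\otimes=\otimes_{\Bbbk}$, graded by $(M\otimes N)_g=\bigoplus_{g'g''=g}M_{g'}\otimes N_{g''}$; $\Bbbk$ is in degree $e$. A colour algebra is a $G$-graded associative unital $\Bbbk$-algebra; it is colour-commutative if $ab=(|a|/|b|)ba$ for all homogeneous $a,b$; a homomorphism of colour algebras is a graded map that is a unital $\Bbbk$-algebra homomorphism. A colour Hopf algebra $H$ is a colour algebra which is also a (coassociative, counital) coalgebra with graded maps $\Delta_H$, $\varepsilon_H$ (write $\Delta_H(h)=h_1\otimes h_2$ with homogeneous components), such that $\varepsilon_H$ is a unital algebra map, $\Delta_H(1_H)=1_H\otimes 1_H$, $\Delta_H(hh')=(|h_2|/|h'_1|)\,h_1h'_1\otimes h_2h'_2$, and with a graded map $\mathcal S_H:H\to H$ (antipode) satisfying $h_1\mathcal S_H(h_2)=\varepsilon_H(h)1_H=\mathcal S_H(h_1)h_2$. A graded $H$-comodule is a graded vector space $M$ with a graded map $\chi_M:M\to H\otimes M$, $\chi_M(m)=m_{(-1)}\otimes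 m_{(0)}$, which is coassociative and counital (left comodule). $H$ is a graded $H$-comodule via $\Delta_H$. A graded $H$-colinear map is a graded map $f$ with $f(m)_{(-1)}\otimes f(m)_{(0)}=m_{(-1)}\otimes f(m_{(0)})$. Coinvariants: $M^{coH}=\{m\in M:\chi_M(m)=1_H\otimes m\}$, a graded subspace. A graded $H$-comodule colour algebra is a colour algebra $A$ that is a graded $H$-comodule with $\chi_A(1_A)=1_H\otimes 1_A$ and $\chi_A(aa')=(|a_{(0)}|/|a'_{(-1)}|)\,a_{(-1)}a'_{(-1)}\otimes a_{(0)}a'_{(0)}$. A graded left $A$-module is a graded vector space that is a left $A$-module with $A_gM_{g'}\subseteq M_{gg'}$. A colour $(A,H)$-Hopf module is a graded left $A$-module and graded $H$-comodule $M$ (same grading) with $\chi_M(am)=(|a_{(0)}|/|m_{(-1)}|)\,a_{(-1)}m_{(-1)}\otimes a_{(0)}m_{(0)}$; $A$ itself is one. *)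

(* Defs.v *)
From HB Require Import structures.
From mathcomp Require Import all_boot all_algebra.
From mathcomp Require Import boolp.

Set Implicit Arguments.
Unset Strict Implicit.
Unset Printing Implicit Defensive.

Import GRing.Theory.
Local Open Scope ring_scope.
Local Open Scope quotient_scope.

(* The abelian grading group G is a zmodType, hence written additively:       *)
(* the identity e is 0, and the product of g and g' is g + g'.                *)

Definition bilinear_map (k : fieldType) (U V W : lmodType k)
    (f : U -> V -> W) : Prop :=
  (forall u, linear (f u)) /\ (forall v, linear (f^~ v)).

(* -------------------------------------------------------------------------- *)
(* Tensor product of two vector spaces: finite formal sums of pairs, two sums *)
(* being identified when every bilinear map gives them the same value.  The   *)
(* universal property is established by tpure_bilinear, tlift_tpure,          *)
(* tlift_linear (existence of the factorization) and tens_sum (uniqueness).   *)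
(* -------------------------------------------------------------------------- *)
Section Tensor.
Variables (k : fieldType) (V W : lmodType k).

Definition tsum (U : lmodType k) (f : V -> W -> U) (s : seq (V * W)) : U :=
  \sum_(x <- s) f x.1 x.2.

Definition tens_rel (s t : seq (V * W)) : bool :=
  `[< forall (U : lmodType k) (f : V -> W -> U),
        bilinear_map f -> tsum f s = tsum f t >].

Lemma tens_rel_refl : reflexive tens_rel.
Proof. by move=> s; apply/asboolP. Qed.

Lemma tens_rel_sym : symmetric tens_rel.
Proof.
by move=> s t; apply/asboolP/asboolP => h U f bf; rewrite (h U f bf).
Qed.

Lemma tens_rel_trans : transitive tens_rel.
Proof.
move=> t s u /asboolP h1 /asboolP h2; apply/asboolP => U f bf.
by rewrite (h1 U f bf) (h2 U f bf).
Qed.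

Canonical tens_equiv :=
  EquivRel tens_rel tens_rel_refl tens_rel_sym tens_rel_trans.

Definition tens := {eq_quot tens_equiv}.

HB.instance Definition _ := EqQuotient.on tens.
HB.instance Definition _ := Choice.on tens.

(* tlift f is the linear map induced by f; it is meaningful (independent of   *)
(* the chosen representative) when f is bilinear, see tlift_tpure below.      *)
Definition tlift (U : lmodType k) (f : V -> W -> U) (t : tens) : U :=
  tsum f (repr t).

Definition tpure (v : V) (w : W) : tens := \pi_tens [:: (v, w)].

Let tadd (x y : tens) : tens := \pi_tens (repr x ++ repr y).
Let tscale (c : k) (x : tens) : tens :=
  \pi_tens [seq (c *: p.1, p.2) | p <- repr x].
Let topp (x : tens) : tens := tscale (-1) x.
Let tzero : tens := \pi_tens [::].

Lemma tlift_pi (U : lmodType k) (f : V -> W -> U) s :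
  bilinear_map f -> tlift f (\pi_tens s) = tsum f s.
Proof.
move=> bf; rewrite /tlift.
have : repr (\pi_tens s) = s %[mod tens] by rewrite reprK.
by move/eqP; rewrite eqmodE => /asboolP h; apply: h.
Qed.

Lemma tens_ext (x y : tens) :
  (forall (U : lmodType k) (f : V -> W -> U), bilinear_map f ->
     tlift f x = tlift f y) -> x = y.
Proof.
move=> h; rewrite -[x]reprK -[y]reprK; apply/eqP; rewrite eqmodE.
by apply/asboolP => U f bf; apply: h.
Qed.

Lemma bilinear_mapZl (U : lmodType k) (f : V -> W -> U) c v w :
  bilinear_map f -> f (c *: v) w = c *: f v w.
Proof.
case=> _ h; have h0 : f 0 w = 0.
  have := h w (-1) 0 0; rewrite scaler0 addr0 scaleN1r addNr; exact.
by have := h w c v 0; rewrite h0 !addr0.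
Qed.

Let tlift_add (U : lmodType k) (f : V -> W -> U) x y :
  bilinear_map f -> tlift f (tadd x y) = tlift f x + tlift f y.
Proof. by move=> bf; rewrite tlift_pi // /tsum big_cat. Qed.

Let tlift_scale (U : lmodType k) (f : V -> W -> U) c x :
  bilinear_map f -> tlift f (tscale c x) = c *: tlift f x.
Proof.
move=> bf; rewrite tlift_pi // /tlift /tsum big_map scaler_sumr.
by apply: eq_bigr => p _ /=; rewrite bilinear_mapZl.
Qed.

Let tlift_zero (U : lmodType k) (f : V -> W -> U) :
  bilinear_map f -> tlift f tzero = 0.
Proof. by move=> bf; rewrite tlift_pi // /tsum big_nil. Qed.

Let taddA : associative tadd.
Proof. by move=> x y z; apply: tens_ext => U f bf; rewrite !tlift_add // addrA. Qed.
Let taddC : commutative tadd.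
Proof. by move=> x y; apply: tens_ext => U f bf; rewrite !tlift_add // addrC. Qed.
Let tadd0 : left_id tzero tadd.
Proof.
by move=> x; apply: tens_ext => U f bf; rewrite tlift_add // tlift_zero // add0r.
Qed.
Let taddN : left_inverse tzero topp tadd.
Proof.
move=> x; apply: tens_ext => U f bf.
by rewrite tlift_add // tlift_scale // tlift_zero // scaleN1r addNr.
Qed.

HB.instance Definition _ := GRing.isZmodule.Build tens taddA taddC tadd0 taddN.

Let tscaleA c d (x : tens) : tscale c (tscale d x) = tscale (c * d) x.
Proof. by apply: tens_ext => U f bf; rewrite !tlift_scale // scalerA. Qed.
Let tscale1 : left_id 1 tscale.
Proof. by move=> x; apply: tens_ext => U f bf; rewrite tlift_scale // scale1r. Qed.
Let tscaleDr : right_distributive tscale +%R.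
Proof.
move=> c x y; apply: tens_ext => U f bf.
by rewrite tlift_add // !tlift_scale // tlift_add // scalerDr.
Qed.
Let tscaleDl x : {morph tscale^~ x : c d / c + d}.
Proof.
move=> c d; apply: tens_ext => U f bf.
by rewrite tlift_add // !tlift_scale // scalerDl.
Qed.

HB.instance Definition _ :=
  GRing.Zmodule_isLmodule.Build k tens tscaleA tscale1 tscaleDr tscaleDl.

Lemma tlift_linear (U : lmodType k) (f : V -> W -> U) :
  bilinear_map f -> linear (tlift f).
Proof. by move=> bf c x y; rewrite -tlift_scale // -tlift_add. Qed.

Lemma tlift_tpure (U : lmodType k) (f : V -> W -> U) v w :
  bilinear_map f -> tlift f (tpure v w) = f v w.
Proof. by move=> bf; rewrite tlift_pi // /tsum big_seq1. Qed.

Lemma tpure_bilinear : bilinear_map tpure.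
Proof.
split=> [v c w w' | w c v v']; apply: tens_ext => U f bf;
  rewrite tlift_linear // !tlift_tpure //.
  by case: bf => + _; apply.
by case: bf => _; apply.
Qed.

Lemma tens_sum (t : tens) : t = \sum_(x <- repr t) tpure x.1 x.2.
Proof.
apply: tens_ext => U f bf; rewrite {1}/tlift /tsum.
have h0 : tlift f 0 = 0 by exact: tlift_zero.
have hD x y : tlift f (x + y) = tlift f x + tlift f y by exact: tlift_add.
by rewrite (big_morph _ hD h0); apply: eq_bigr => x _; rewrite tlift_tpure.
Qed.

End Tensor.

Arguments tpure {k V W} v w.

Definition tmap (k : fieldType) (V V' W W' : lmodType k)
    (f : V -> V') (g : W -> W') : tens V W -> tens V' W' :=
  tlift (fun v w => tpure (f v) (g w)).

Definition tassoc (k : fieldType) (U V W : lmodType k) :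
    tens (tens U V) W -> tens U (tens V W) :=
  tlift (fun t w => tlift (fun u v => tpure u (tpure v w)) t).

(* -------------------------------------------------------------------------- *)
(* Associative unital k-algebras.  GRing.algType is not used because it       *)
(* excludes the zero algebra.                                                 *)
(* -------------------------------------------------------------------------- *)
Record ualgebra (k : fieldType) := UAlgebra {
  ualg_sort :> lmodType k;
  amul : ualg_sort -> ualg_sort -> ualg_sort;
  aone : ualg_sort;
  amul_bilinear : bilinear_map amul;
  amulA : associative amul;
  amul1l : left_id aone amul;
  amul1r : right_id aone amul }.

Arguments amul {k u} x y : rename.
Arguments aone {k} u : rename.

Section Graded.
Variables (k : fieldType) (G : zmodType).

Record is_bicharacter (beta : G -> G -> k) : Prop := {
  bichar_neq0 : forall g h, beta g h != 0;
  bicharDr : forall g h l, beta g (h + l) = beta g h * beta g l;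
  bicharDl : forall g h l, beta (g + h) l = beta g l * beta h l }.

Definition symmetric_bicharacter (beta : G -> G -> k) : Prop :=
  forall g h, beta g h * beta h g = 1.

(* V is the internal direct sum of the subspaces (D g), g in G. *)
Record is_grading (V : lmodType k) (D : G -> V -> Prop) : Prop := {
  grading0 : forall g, D g 0;
  grading_lin : forall g (c : k) u v, D g u -> D g v -> D g (c *: u + v);
  grading_span : forall v, exists (s : seq G) (f : G -> V),
    (forall g, D g (f g)) /\ v = \sum_(g <- s) f g;
  grading_indep : forall (s : seq G) (f : G -> V), uniq s ->
    (forall g, D g (f g)) -> \sum_(g <- s) f g = 0 ->
    forall g, g \in s -> f g = 0 }.

Definition is_graded_map (V W : lmodType k) (D : G -> V -> Prop)
    (D' : G -> W -> Prop) (f : V -> W) : Prop :=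
  forall g v, D g v -> D' g (f v).

(* k is concentrated in degree e. *)
Definition deg_ground (g : G) (c : k^o) : Prop := g = 0 \/ c = 0.

Definition deg_tens (V W : lmodType k) (D : G -> V -> Prop)
    (D' : G -> W -> Prop) (g : G) (t : tens V W) : Prop :=
  exists s : seq (V * W),
    (forall x, x \in s -> exists g' g'', [/\ g' + g'' = g, D g' x.1 & D' g'' x.2])
    /\ t = \sum_(x <- s) tpure x.1 x.2.

(* Sweedler notation: (hexp D D' t s) says that t is the sum of the v (x) w   *)
(* for ((g, v), (g', w)) in s, where v, w are homogeneous of degrees g, g'.   *)
Definition hexp (V W : lmodType k) (D : G -> V -> Prop) (D' : G -> W -> Prop)
    (t : tens V W) (s : seq ((G * V) * (G * W))) : Prop :=
  (forall x, x \in s -> D x.1.1 x.1.2 /\ D' x.2.1 x.2.2)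
  /\ t = \sum_(x <- s) tpure x.1.2 x.2.2.

(* (v (x) w)(v' (x) w') = (|w| / |v'|) v v' (x) w w' on homogeneous expansions *)
Definition hprod (beta : G -> G -> k) (V W V' W' V'' W'' : lmodType k)
    (mulV : V -> V' -> V'') (mulW : W -> W' -> W'')
    (s : seq ((G * V) * (G * W))) (s' : seq ((G * V') * (G * W'))) :
    tens V'' W'' :=
  \sum_(x <- s) \sum_(y <- s')
    beta x.2.1 y.1.1 *: tpure (mulV x.1.2 y.1.2) (mulW x.2.2 y.2.2).

Record is_colour_algebra (A : ualgebra k) (degA : G -> A -> Prop) : Prop := {
  colour_algebra_grading : is_grading degA;
  colour_algebra1 : degA 0 (aone A);
  colour_algebraM : forall g h a b,
    degA g a -> degA h b -> degA (g + h) (amul a b) }.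

Definition colour_commutative (beta : G -> G -> k) (A : ualgebra k)
    (degA : G -> A -> Prop) : Prop :=
  forall g h a b, degA g a -> degA h b -> amul a b = beta g h *: amul b a.

Record is_colour_algebra_hom (A B : ualgebra k) (degA : G -> A -> Prop)
    (degB : G -> B -> Prop) (f : {linear A -> B}) : Prop := {
  colour_hom_graded : is_graded_map degA degB f;
  colour_hom1 : f (aone A) = aone B;
  colour_homM : forall a b, f (amul a b) = amul (f a) (f b) }.

Record is_coalgebra (C : lmodType k) (Delta : {linear C -> tens C C})
    (eps : {linear C -> k^o}) : Prop := {
  coalgebra_coassoc : forall c,
    tassoc (tmap Delta id (Delta c)) = tmap id Delta (Delta c);
  coalgebra_counitl : forall c, tlift (fun x y => eps x *: y) (Delta c) = c;
  coalgebra_counitr : forall c, tlift (fun x y => eps y *: x) (Delta c) = c }.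

Record is_colour_hopf_algebra (beta : G -> G -> k) (H : ualgebra k)
    (degH : G -> H -> Prop) (Delta : {linear H -> tens H H})
    (eps : {linear H -> k^o}) (S : {linear H -> H}) : Prop := {
  hopf_colour_algebra : is_colour_algebra degH;
  hopf_coalgebra : is_coalgebra Delta eps;
  hopf_Delta_graded : is_graded_map degH (deg_tens degH degH) Delta;
  hopf_eps_graded : is_graded_map degH deg_ground eps;
  hopf_eps1 : eps (aone H) = 1;
  hopf_epsM : forall h h', eps (amul h h') = eps h * eps h';
  hopf_Delta1 : Delta (aone H) = tpure (aone H) (aone H);
  hopf_DeltaM : forall h h' s s',
    hexp degH degH (Delta h) s -> hexp degH degH (Delta h') s' ->
    Delta (amul h h') = hprod beta amul amul s s';
  hopf_S_graded : is_graded_map degH degH S;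
  hopf_S_right : forall h,
    tlift (fun x y => amul x (S y)) (Delta h) = eps h *: aone H;
  hopf_S_left : forall h,
    tlift (fun x y => amul (S x) y) (Delta h) = eps h *: aone H }.

Record is_graded_comodule (H M : lmodType k) (degH : G -> H -> Prop)
    (Delta : {linear H -> tens H H}) (eps : {linear H -> k^o})
    (degM : G -> M -> Prop) (chi : {linear M -> tens H M}) : Prop := {
  comodule_grading : is_grading degM;
  comodule_graded : is_graded_map degM (deg_tens degH degM) chi;
  comodule_coassoc : forall m,
    tassoc (tmap Delta id (chi m)) = tmap id chi (chi m);
  comodule_counit : forall m, tlift (fun h m' => eps h *: m') (chi m) = m }.

Record is_graded_colinear (H M N : lmodType k) (degM : G -> M -> Prop)
    (chiM : {linear M -> tens H M}) (degN : G -> N -> Prop)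
    (chiN : {linear N -> tens H N}) (f : {linear M -> N}) : Prop := {
  colinear_graded : is_graded_map degM degN f;
  colinear_comm : forall m, chiN (f m) = tmap id f (chiM m) }.

Record is_comodule_colour_algebra (beta : G -> G -> k) (H : ualgebra k)
    (degH : G -> H -> Prop) (Delta : {linear H -> tens H H})
    (eps : {linear H -> k^o}) (A : ualgebra k) (degA : G -> A -> Prop)
    (chiA : {linear A -> tens H A}) : Prop := {
  comodule_algebra_algebra : is_colour_algebra degA;
  comodule_algebra_comodule : is_graded_comodule degH Delta eps degA chiA;
  comodule_algebra1 : chiA (aone A) = tpure (aone H) (aone A);
  comodule_algebraM : forall a a' s s',
    hexp degH degA (chiA a) s -> hexp degH degA (chiA a') s' ->
    chiA (amul a a') = hprod beta amul amul s s' }.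

Record is_graded_module (A : ualgebra k) (degA : G -> A -> Prop)
    (M : lmodType k) (degM : G -> M -> Prop) (act : A -> M -> M) : Prop := {
  module_grading : is_grading degM;
  module_bilinear : bilinear_map act;
  module1 : forall m, act (aone A) m = m;
  moduleM : forall a b m, act (amul a b) m = act a (act b m);
  module_graded : forall g h a m,
    degA g a -> degM h m -> degM (g + h) (act a m) }.

Record is_colour_hopf_module (beta : G -> G -> k) (H : ualgebra k)
    (degH : G -> H -> Prop) (Delta : {linear H -> tens H H})
    (eps : {linear H -> k^o}) (A : ualgebra k) (degA : G -> A -> Prop)
    (chiA : {linear A -> tens H A}) (M : lmodType k) (degM : G -> M -> Prop)
    (chiM : {linear M -> tens H M}) (act : A -> M -> M) : Prop := {
  hopf_module_module : is_graded_module degA degM act;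
  hopf_module_comodule : is_graded_comodule degH Delta eps degM chiM;
  hopf_module_compat : forall a m s s',
    hexp degH degA (chiA a) s -> hexp degH degM (chiM m) s' ->
    chiM (act a m) = hprod beta amul act s s' }.

(* p_M(m) = theta (S m_(-1)) m_(0) *)
Definition hopf_proj (H A : ualgebra k) (M : lmodType k) (S : {linear H -> H})
    (theta : {linear H -> A}) (act : A -> M -> M)
    (chi : {linear M -> tens H M}) (m : M) : M :=
  tlift (fun h m' => act (theta (S h)) m') (chi m).

End Graded.

Section Coinvariants.
Variables (k : fieldType) (H : ualgebra k) (M : lmodType k).
Variable chi : {linear M -> tens H M}.

Definition coinv : {pred M} := [pred m | chi m == tpure (aone H) m].

Lemma coinv_submod_closed : submod_closed coinv.
Proof.
have [lin _] := @tpure_bilinear k H M.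
split=> [|c u v]; rewrite !inE.
  by have := lin (aone H) (-1) 0 0; rewrite !scaleN1r !addNr linear0 => ->.
by rewrite linearP => /eqP-> /eqP->; rewrite lin.
Qed.

HB.instance Definition _ :=
  GRing.isSubmodClosed.Build k M coinv coinv_submod_closed.

Record coinvariants := Coinvariants { coinv_val : M; _ : coinv_val \in coinv }.

HB.instance Definition _ := [isSub for coinv_val].
HB.instance Definition _ := [Choice of coinvariants by <:].
HB.instance Definition _ := [SubChoice_isSubZmodule of coinvariants by <:].
HB.instance Definition _ := [SubZmodule_isSubLmodule of coinvariants by <:].

End Coinvariants.

(* Main.v *)
(* Put p = p_M and phi = theta o S.  Since phi is the convolution inverse of
   theta, every m equals theta(m_(-1)) p(m_(0)).  Applying the coaction to this
   identity and cancelling the convolution-invertible map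
   h |-> h_1 (x) theta(h_2) shows that p(m) is coinvariant.  For n coinvariant,
   p(theta(h) n) = eps(h) n, whence p(theta(h) m) = eps(h) p(m) for all m; moving
   theta(m_(-1)) past a in a m = a theta(m_(-1)) p(m_(0)) then gives
   p(a m) = p(a p(m)), which is (1) and the associativity in (2).  Homogeneous
   components of a coinvariant m = p(m) are obtained by applying p, so the
   coinvariants are graded. *)
From HB Require Import structures.
Require Import Defs.
From mathcomp Require Import all_boot all_algebra.
From mathcomp Require Import boolp.

Set Implicit Arguments.
Unset Strict Implicit.
Unset Printing Implicit Defensive.

Import GRing.Theory.
Local Open Scope ring_scope.

(** * Linear maps and maps out of the tensor product *)

Section LinearMaps.
Context {k : fieldType} {U V : lmodType k} {f : U -> V}.
Hypothesis lf : linear f.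

(** Bundles a bare proof of [linear f], the form supplied by [bilinear_map], so that the library
    lemmas on linear maps apply. *)
Definition linear_of : {linear U -> V} :=
  HB.pack f (GRing.isLinear.Build k U V *:%R f lf).

Lemma lin0 : f 0 = 0.
Proof. exact: (linear0 linear_of). Qed.

Lemma linZ c u : f (c *: u) = c *: f u.
Proof. exact: (linearZZ linear_of). Qed.

Lemma lin_sum (I : Type) (r : seq I) (P : pred I) (F : I -> U) :
  f (\sum_(i <- r | P i) F i) = \sum_(i <- r | P i) f (F i).
Proof. exact: (linear_sum linear_of). Qed.

Lemma lin_comp (W : lmodType k) (g : V -> W) :
  linear g -> linear (fun u => g (f u)).
Proof. by move=> lg c u v; rewrite lf lg. Qed.

(** Both sides are finite sums over the same representative [repr t], so linearity of [f] suffices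
    for any [b]. *)
Lemma lin_tlift (W X : lmodType k) (b : W -> X -> U) t :
  f (tlift b t) = tlift (fun w x => f (b w x)) t.
Proof. by rewrite /tlift /tsum lin_sum. Qed.

End LinearMaps.

Section TensorMaps.
Context {k : fieldType} {V W : lmodType k}.

Lemma eq_tlift (U : lmodType k) (f g : V -> W -> U) t :
  (forall v w, f v w = g v w) -> tlift f t = tlift g t.
Proof. by move=> fg; apply: eq_bigr => x _; apply: fg. Qed.

Lemma tlift_linear_param (U X : lmodType k) (f : X -> V -> W -> U) t :
  (forall v w, linear (fun x => f x v w)) -> linear (fun x => tlift (f x) t).
Proof.
move=> lf c x y; rewrite /tlift /tsum scaler_sumr -big_split.
by apply: eq_bigr => p _; rewrite lf.
Qed.

Lemma tlift_sum (U : lmodType k) (f : V -> W -> U) (I : Type) (r : seq I) v w :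
  bilinear_map f ->
  tlift f (\sum_(i <- r) tpure (v i) (w i)) = \sum_(i <- r) f (v i) (w i).
Proof.
move=> bf; rewrite (lin_sum (tlift_linear bf)).
by apply: eq_bigr => i _; rewrite tlift_tpure.
Qed.

Lemma tens_linear_ext (U : lmodType k) (f g : tens V W -> U) :
  linear f -> linear g -> (forall v w, f (tpure v w) = g (tpure v w)) ->
  f =1 g.
Proof.
move=> lf lg fg t; rewrite (tens_sum t) (lin_sum lf) (lin_sum lg).
by apply: eq_bigr => x _; apply: fg.
Qed.

Lemma bilinear_comp (U V' W' : lmodType k) (f : V' -> W' -> U)
    (g : V -> V') (h : W -> W') :
  bilinear_map f -> linear g -> linear h ->
  bilinear_map (fun v w => f (g v) (h w)).
Proof.
by move=> [fr fl] lg lh; split=> [v | w] c x y; rewrite ?lg ?lh (fr, fl).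
Qed.

Lemma tmap_tpure (V' W' : lmodType k) (f : V -> V') (g : W -> W') v w :
  linear f -> linear g -> tmap f g (tpure v w) = tpure (f v) (g w).
Proof.
move=> lf lg; rewrite /tmap tlift_tpure //.
exact: (bilinear_comp (@tpure_bilinear _ _ _) lf lg).
Qed.

Lemma tmap_linear (V' W' : lmodType k) (f : V -> V') (g : W -> W') :
  linear f -> linear g -> linear (tmap f g).
Proof.
move=> lf lg; apply: tlift_linear.
exact: (bilinear_comp (@tpure_bilinear _ _ _) lf lg).
Qed.

End TensorMaps.

Lemma linear_idfun (k : fieldType) (V : lmodType k) : linear (@id V).
Proof. by []. Qed.

(** Lets [tassoc] be evaluated on pure tensors through [tlift_tpure]. *)
Lemma tassoc_bilinear (k : fieldType) (U V W : lmodType k) :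
  bilinear_map (fun (t : tens U V) (w : W) =>
    tlift (fun u v => tpure u (tpure v w)) t).
Proof.
have [pr pl] := @tpure_bilinear k U (tens V W).
have [qr ql] := @tpure_bilinear k V W.
split=> [t | w].
  by apply: tlift_linear_param => u v; apply: (lin_comp (qr v) (pr u)).
apply: tlift_linear; split=> [u | v]; last exact: pl.
exact: (lin_comp (ql w) (pr u)).
Qed.

(** * Gradings and extension from homogeneous elements *)

Section GradedSpaces.
Context {k : fieldType} {G : zmodType} {V : lmodType k} {D : G -> V -> Prop}.
Hypothesis gr : is_grading D.

Lemma grading_sum (I : Type) (r : seq I) (P : pred I) (f : I -> V) g :
  (forall i, P i -> D g (f i)) -> D g (\sum_(i <- r | P i) f i).
Proof.
move=> Df; elim/big_ind: _ => //; first exact: grading0.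
by move=> u v Du Dv; rewrite -[u]scale1r; apply: grading_lin.
Qed.

Lemma homogeneous_decomposition (v : V) : exists s : seq (G * V),
  (forall x, x \in s -> D x.1 x.2) /\ v = \sum_(x <- s) x.2.
Proof.
have [s [f [Df ->]]] := grading_span gr v.
exists [seq (g, f g) | g <- s]; rewrite big_map.
by split=> // x /mapP[g _ ->].
Qed.

(** Grouping the terms by degree, independence of the components makes each group sum to 0, and
    [L g] is linear on the group of degree [g]. This is the well-definedness behind
    [graded_linear_lift]. *)
Lemma homogeneous_sum0 (U : lmodType k) (L : G -> V -> U) (s : seq (G * V)) :
  (forall g, linear (L g)) -> (forall x, x \in s -> D x.1 x.2) ->
  \sum_(x <- s) x.2 = 0 -> \sum_(x <- s) L x.1 x.2 = 0.
Proof.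
move=> lL Ds s0; pose r := undup [seq x.1 | x <- s].
have part (X : lmodType k) (F : G * V -> X) :
    \sum_(x <- s) F x = \sum_(g <- r) \sum_(x <- s | x.1 == g) F x.
  rewrite (exchange_big_dep predT) //=; apply: eq_big_seq => x xs.
  rewrite big_mkcond (bigD1_seq x.1) ?undup_uniq ?mem_undup ?map_f //= eqxx.
  by rewrite big1 ?addr0 // => g /negPf; rewrite eq_sym => ->.
pose f g := \sum_(x <- s | x.1 == g) x.2.
have Df g : D g (f g).
  rewrite /f big_seq_cond; apply: grading_sum => x /andP[xs /eqP <-].
  exact: Ds.
have f0 := grading_indep gr (undup_uniq _) Df (etrans (esym (part _ _)) s0).
rewrite part big_seq big1 // => g gr0.
rewrite (eq_bigr (fun x => L g x.2)) => [|x /eqP -> //].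
by rewrite -(lin_sum (lL g)) -/(f g) f0 // (lin0 (lL g)).
Qed.

Lemma graded_linear_ext (U : lmodType k) (f f' : V -> U) :
  linear f -> linear f' -> (forall g v, D g v -> f v = f' v) -> f =1 f'.
Proof.
move=> lf lf' ff' v; have [s [Ds ->]] := homogeneous_decomposition v.
rewrite (lin_sum lf) (lin_sum lf') !big_seq.
by apply: eq_bigr => x /Ds; apply: ff'.
Qed.

(** Makes precise the convention that formulas are written for homogeneous elements and extended
    linearly, even when they depend on the degree. *)
Lemma graded_linear_lift (U : lmodType k) (L : G -> V -> U) :
  (forall g, linear (L g)) ->
  exists F : V -> U, linear F /\ forall g v, D g v -> F v = L g v.
Proof.
move=> lL; have [s sP] := choice homogeneous_decomposition.
pose F v := \sum_(x <- s v) L x.1 x.2.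
have FE v t : (forall x, x \in t -> D x.1 x.2) -> v = \sum_(x <- t) x.2 ->
    F v = \sum_(x <- t) L x.1 x.2.
  move=> Dt vt; have [Ds vs] := sP v; apply/eqP; rewrite -subr_eq0; apply/eqP.
  rewrite -sumrN.
  (* Two decompositions of [v] give the same value: their formal difference is a homogeneous family
     with sum 0. *)
  have := @homogeneous_sum0 _ L (s v ++ [seq (x.1, - x.2) | x <- t]) lL.
  rewrite !big_cat !big_map /= -vs sumrN -vt subrr.
  move=> h; rewrite -[RHS]h // => [|x].
    congr (_ + _); apply: eq_bigr => x _.
    by rewrite -[in RHS]scaleN1r (linZ (lL _)) scaleN1r.
  rewrite mem_cat => /orP[/Ds //|/mapP[y /Dt Dy ->]] /=.
  rewrite -scaleN1r -[_ *: _]addr0.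
  by apply: (grading_lin gr) => //; apply: grading0.
exists F; split=> [c u v | g v Dv]; last first.
  rewrite (FE v [:: (g, v)]) ?big_seq1 // => x.
  by rewrite inE => /eqP ->.
have [[Du su] [Dv sv]] := (sP u, sP v).
rewrite (FE _ ([seq (x.1, c *: x.2) | x <- s u] ++ s v)).
- rewrite big_cat big_map /=; congr (_ + _); rewrite scaler_sumr.
  by apply: eq_bigr => x _; rewrite (linZ (lL _)).
- move=> x; rewrite mem_cat => /orP[/mapP[y /Du Dy ->]|/Dv //] /=.
  by rewrite -[_ *: _]addr0; apply: (grading_lin gr) => //; apply: grading0.
- by rewrite big_cat big_map /= -scaler_sumr -su -sv.
Qed.

End GradedSpaces.

Lemma tens_id (k : fieldType) (V W : lmodType k) (t : tens V W) :
  tlift tpure t = t.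
Proof. by rewrite [RHS]tens_sum. Qed.

Lemma hexp_exists (k : fieldType) (G : zmodType) (V W : lmodType k)
    (D : G -> V -> Prop) (D' : G -> W -> Prop) (t : tens V W) :
  is_grading D -> is_grading D' -> exists s, hexp D D' t s.
Proof.
move=> gr gr'; have [pr pl] := @tpure_bilinear k V W.
have [d dP] := choice (homogeneous_decomposition gr).
have [d' dP'] := choice (homogeneous_decomposition gr').
exists (flatten [seq [seq (x, y) | x <- d p.1, y <- d' p.2] | p <- repr t]).
split=> [z /flatten_mapP[p _ /allpairsP[[x y] /= [xd yd ->]]] | ].
  by split; [apply: (dP p.1).1 | apply: (dP' p.2).1].
rewrite {1}(tens_sum t) big_flatten big_map; apply: eq_bigr => p _.
rewrite big_allpairs /= {1}(dP p.1).2 {1}(dP' p.2).2 (lin_sum (pl _)).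
by apply: eq_bigr => x _; rewrite (lin_sum (pr _)).
Qed.

(** The operator a.(x (x) m) = (|a|/|x|) x (x) am, in which [a] moves past [x]. As a globally
    bilinear map it absorbs the bicharacter, so later computations can avoid homogeneous
    expansions. *)
Lemma twisted_action (k : fieldType) (G : zmodType) (beta : G -> G -> k)
    (A V M M' : lmodType k) (degA : G -> A -> Prop) (degV : G -> V -> Prop)
    (act : A -> M -> M') :
  is_grading degA -> is_grading degV -> bilinear_map act ->
  exists T : A -> tens V M -> tens V M', bilinear_map T /\
    forall g h a x m, degA g a -> degV h x ->
      T a (tpure x m) = beta g h *: tpure x (act a m).
Proof.
move=> grA grV [actr actl]; have [pr pl] := @tpure_bilinear k V M'.
have scale_linear g h : linear (fun x : V => beta g h *: x).
  by move=> c x y; rewrite scalerDr !scalerA mulrC.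
(* [sg g] is the linear map scaling the component of degree [h] by [beta g h]; a second lift, over
   the degree of [a], then yields [T]. *)
have /choice[sg sgP] g := graded_linear_lift grV (scale_linear g).
pose L t g a := tlift (fun x m => tpure (sg g x) (act a m)) t.
have L_linear t g : linear (L t g).
  by apply: tlift_linear_param => x m; apply: (lin_comp (actl m) (pr _)).
have L_bil g a : bilinear_map (fun x m => tpure (sg g x) (act a m)).
  exact: bilinear_comp (@tpure_bilinear k V M') (sgP g).1 (actr a).
have /choice[T TP] t := graded_linear_lift grA (L_linear t).
exists (fun a t => T t a); split; first split=> [a c t u | t].
- move: a; apply: (graded_linear_ext grA).
  + exact: (TP _).1.
  + move=> d a b; rewrite (TP t).1 (TP u).1 scalerDr !scalerDr !scalerA.
    by rewrite [c * d]mulrC addrACA.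
  + move=> g a Da; rewrite !((TP _).2 _ _ Da) /L.
    exact: (tlift_linear (L_bil g a)).
- exact: (TP t).1.
- move=> g h a x m Da Dx.
  rewrite ((TP _).2 _ _ Da) /L tlift_tpure // ((sgP g).2 _ _ Dx).
  exact: (linZ (pl _)).
Qed.

(** * Convolution along a comodule *)

Section Convolution.
Context {k : fieldType} {H M : lmodType k} {Delta : {linear H -> tens H H}}
  {eps : {linear H -> k^o}} {chi : {linear M -> tens H M}}.
Hypothesis coassoc : forall m,
  tassoc (tmap Delta id (chi m)) = tmap id chi (chi m).
Hypothesis counit : forall m, tlift (fun h m' => eps h *: m') (chi m) = m.

(** In Sweedler notation, m |-> b(m_(-1), R(m_(0))): [b] acts by convolution on linear maps out of
    [M]. *)
Definition conv (Z Z' : lmodType k) (b : H -> Z -> Z') (R : M -> Z) (m : M) :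
    Z' := tlift (fun h n => b h (R n)) (chi m).

Lemma conv_linear (Z Z' : lmodType k) (b : H -> Z -> Z') (R : M -> Z) :
  bilinear_map b -> linear R -> linear (conv b R).
Proof.
move=> bb lR; apply: (lin_comp (linearP chi)); apply: tlift_linear.
exact: (bilinear_comp bb (@linear_idfun _ _) lR).
Qed.

(** Coassociativity of the coaction turns acting by a convolution product into acting twice. *)
Lemma conv_coassoc (Z Z' Z'' : lmodType k) (b : H -> Z -> Z')
    (b' : H -> Z' -> Z'') (R : M -> Z) m :
  bilinear_map b -> bilinear_map b' -> linear R ->
  tlift (fun h n => tlift (fun x y => b' x (b y (R n))) (Delta h)) (chi m)
    = conv b' (conv b R) m.
Proof.
move=> bb bb' lR; have [br bl] := bb; have [br' bl'] := bb'.
have bilR n : bilinear_map (fun x y => b' x (b y (R n))).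
  split=> [x | y]; last exact: bl'.
  exact: (lin_comp (bl _) (br' x)).
have bilb : bilinear_map (fun y n => b y (R n)).
  exact: (bilinear_comp bb (@linear_idfun _ _) lR).
pose F (x : H) (t : tens H M) := b' x (tlift (fun y n => b y (R n)) t).
have F_bil : bilinear_map F.
  split=> [x | t]; last exact: bl'.
  exact: (lin_comp (tlift_linear bilb) (br' x)).
have F_linear := tlift_linear F_bil.
have [pr pl] := @tpure_bilinear k H (tens H M).
have [qr ql] := @tpure_bilinear k H M.
have assoc_bil (w : M) : bilinear_map
    (fun u v : H => tpure u (tpure v w)).
  by split=> [u | v]; [apply: (lin_comp (ql w) (pr u)) | apply: pl].
(* [F] evaluates an element of H (x) (H (x) M), so both sides become its values on the two sides of
   the coassociativity identity. *)
transitivity (tlift F (tmap id chi (chi m))); last first.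
  rewrite /tmap (lin_tlift F_linear); apply: eq_tlift => x n.
  by rewrite tlift_tpure.
rewrite -coassoc /tassoc /tmap.
rewrite (lin_tlift (tlift_linear (tassoc_bilinear _ _ _))).
rewrite (lin_tlift F_linear); apply: eq_tlift => h n.
rewrite tlift_tpure; last exact: tassoc_bilinear.
rewrite (lin_tlift F_linear); apply: eq_tlift => x y.
by rewrite tlift_tpure // /F tlift_tpure.
Qed.

(** The last premise says that [b'] is a left convolution inverse of [b]; coassociativity brings the
    two together and the counit finishes. *)
Lemma conv_cancel (Z Z' : lmodType k) (b : H -> Z -> Z') (b' : H -> Z' -> Z)
    (R : M -> Z) m :
  bilinear_map b -> bilinear_map b' -> linear R ->
  (forall h z, tlift (fun x y => b' x (b y z)) (Delta h) = eps h *: z) ->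
  conv b' (conv b R) m = R m.
Proof.
move=> bb bb' lR b'bE; rewrite -conv_coassoc // -[in RHS](counit m).
by rewrite (lin_tlift lR); apply: eq_tlift => h n; rewrite b'bE (linZ lR).
Qed.

End Convolution.

(** * The projection and the convolution inverse of theta *)

Section HopfProjection.
Variables (k : fieldType) (G : zmodType) (beta : G -> G -> k).
Hypothesis beta_bichar : is_bicharacter beta.
Variables (H : ualgebra k) (degH : G -> H -> Prop).
Variables (Delta : {linear H -> tens H H}) (eps : {linear H -> k^o}).
Variable S : {linear H -> H}.
Hypothesis H_hopf : is_colour_hopf_algebra beta degH Delta eps S.
Variables (A : ualgebra k) (degA : G -> A -> Prop).
Variable chiA : {linear A -> tens H A}.
Hypothesis A_comod : is_comodule_colour_algebra beta degH Delta eps degA chiA.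
Hypothesis A_comm : colour_commutative beta degA.
Variables (M : lmodType k) (degM : G -> M -> Prop).
Variables (chiM : {linear M -> tens H M}) (act : A -> M -> M).
Hypothesis M_hopf :
  is_colour_hopf_module beta degH Delta eps degA chiA degM chiM act.
Variable theta : {linear H -> A}.
Hypothesis theta_colinear : is_graded_colinear degH Delta degA chiA theta.
Hypothesis theta_hom : is_colour_algebra_hom degH degA theta.

Let grH : is_grading degH :=
  colour_algebra_grading (hopf_colour_algebra H_hopf).
Let grA : is_grading degA :=
  colour_algebra_grading (comodule_algebra_algebra A_comod).
Let M_module : is_graded_module degA degM act := hopf_module_module M_hopf.
Let M_comodule : is_graded_comodule degH Delta eps degM chiM :=
  hopf_module_comodule M_hopf.
Let grM : is_grading degM := module_grading M_module.
Let act_bil : bilinear_map act := module_bilinear M_module.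
Let mulH_bil : bilinear_map (@amul k H) := @amul_bilinear k H.

Local Notation p := (hopf_proj S theta act chiM).
Local Notation phi := (fun h => theta (S h)).
Local Notation one := (tpure (aone H)).

Lemma bicharacter0r g : beta g 0 = 1.
Proof.
have := bicharDr beta_bichar g 0 0; rewrite addr0 -{1}[beta g 0]mulr1.
by move/(mulfI (bichar_neq0 beta_bichar g 0)).
Qed.

(** The right antipode axiom at the group-like element [aone H]. *)
Lemma antipode1 : S (aone H) = aone H.
Proof.
have bil : bilinear_map (fun x y : H => amul x (S y)).
  exact: (bilinear_comp mulH_bil (@linear_idfun _ _) (linearP S)).
have := hopf_S_right H_hopf (aone H).
rewrite (hopf_Delta1 H_hopf) tlift_tpure // amul1l (hopf_eps1 H_hopf).
by rewrite scale1r.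
Qed.

Let act_theta_bil : bilinear_map (fun h => act (theta h)).
Proof. exact: (bilinear_comp act_bil (linearP theta) (@linear_idfun _ _)). Qed.

Let act_phi_bil : bilinear_map (fun h => act (phi h)).
Proof.
exact: (bilinear_comp act_theta_bil (linearP S) (@linear_idfun _ _)).
Qed.

Lemma hopf_proj_linear : linear p.
Proof. exact: (lin_comp (linearP chiM) (tlift_linear act_phi_bil)). Qed.

(** The algebra map [theta] carries h_1 S(h_2) = eps(h) 1 from [H] to [A]; [phi_theta] does the same
    for the left antipode axiom. *)
Lemma theta_phi h m :
  tlift (fun x y => act (theta x) (act (phi y) m)) (Delta h) = eps h *: m.
Proof.
pose L x := act (theta x) m.
have lL : linear L by apply: act_theta_bil.2.
rewrite -[in RHS](module1 M_module m) -(colour_hom1 theta_hom).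
rewrite -[RHS](linZ lL) -(hopf_S_right H_hopf) (lin_tlift lL).
apply: eq_tlift => x y.
by rewrite /L (colour_homM theta_hom) (moduleM M_module).
Qed.

Lemma phi_theta h m :
  tlift (fun x y => act (phi x) (act (theta y) m)) (Delta h) = eps h *: m.
Proof.
pose L x := act (theta x) m.
have lL : linear L by apply: act_theta_bil.2.
rewrite -[in RHS](module1 M_module m) -(colour_hom1 theta_hom).
rewrite -[RHS](linZ lL) -(hopf_S_left H_hopf) (lin_tlift lL).
apply: eq_tlift => x y.
by rewrite /L (colour_homM theta_hom) (moduleM M_module).
Qed.

Lemma theta_hopf_proj m :
  tlift (fun h n => act (theta h) (p n)) (chiM m) = m.
Proof.
exact: (conv_cancel (comodule_coassoc M_comodule) (comodule_counit M_comodule)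
  m act_phi_bil act_theta_bil (@linear_idfun _ _) theta_phi).
Qed.

Lemma hopf_proj_coinv_id m : m \in coinv chiM -> p m = m.
Proof.
rewrite inE /hopf_proj => /eqP ->; rewrite tlift_tpure // antipode1.
by rewrite (colour_hom1 theta_hom) (module1 M_module).
Qed.

Lemma hopf_proj_graded : is_graded_map degM degM p.
Proof.
move=> g m /(comodule_graded M_comodule)[s [Ds ms]].
rewrite /hopf_proj ms tlift_sum // big_seq; apply: grading_sum => // x xs.
have [g1 [g2 [<- D1 D2]]] := Ds x xs.
apply: (module_graded M_module) => //.
by apply: (colour_hom_graded theta_hom); apply: (hopf_S_graded H_hopf).
Qed.

(** Left multiplication on the first tensor factor; no degrees are interchanged, so no sign
    appears. *)
Let mulT (h : H) (t : tens H M) : tens H M := tmap (amul h) id t.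

Let mulT_tpure h x m : mulT h (tpure x m) = tpure (amul h x) m.
Proof. by rewrite /mulT tmap_tpure //; apply: mulH_bil.1. Qed.

Let mulT_bil : bilinear_map mulT.
Proof.
split=> [h | t]; first by apply: tmap_linear => //; apply: mulH_bil.1.
apply: tlift_linear_param => x m.
exact: (lin_comp (mulH_bil.2 x) ((@tpure_bilinear k H M).2 m)).
Qed.

(** * The twisted action on H (x) M and coinvariance of the projection *)

Section TwistedAction.
(** Stands for the operator of [twisted_action], which is given there only by existence. *)
Variable actT : A -> tens H M -> tens H M.
Hypothesis actT_bil : bilinear_map actT.
Hypothesis actTE : forall g h a x m, degA g a -> degH h x ->
  actT a (tpure x m) = beta g h *: tpure x (act a m).

Lemma actT_one a m : actT a (one m) = one (act a m).
Proof.
have [pr _] := @tpure_bilinear k H M.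
move: a; apply: (graded_linear_ext grA (actT_bil.2 _)).
  exact: (lin_comp (act_bil.2 m) (pr _)).
move=> g a Da.
rewrite (actTE _ Da (colour_algebra1 (hopf_colour_algebra H_hopf))).
by rewrite bicharacter0r scale1r.
Qed.

Lemma actT1 t : actT (aone A) t = t.
Proof.
move: t; apply: tens_linear_ext => [||x m] //; first exact: actT_bil.1.
have [_ pl] := @tpure_bilinear k H M.
move: x; apply: (graded_linear_ext grH (lin_comp (pl m) (actT_bil.1 _)) (pl m)).
move=> h x Dx.
rewrite (actTE _ (colour_algebra1 (comodule_algebra_algebra A_comod)) Dx).
rewrite (module1 M_module).
have := bicharDl beta_bichar 0 0 h; rewrite addr0 -{1}[beta 0 h]mulr1.
by move/(mulfI (bichar_neq0 beta_bichar 0 h)) => <-; rewrite scale1r.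
Qed.

Lemma actTM a b t : actT (amul a b) t = actT a (actT b t).
Proof.
have [_ pl] := @tpure_bilinear k H M.
have [Ar Al] := actT_bil; have [mr ml] := @amul_bilinear k A.
move: t; apply: tens_linear_ext => [||x m]; first exact: Ar.
  exact: (lin_comp (Ar b) (Ar a)).
move: x; apply: (graded_linear_ext grH) => [||h x Dx].
- exact: (lin_comp (pl m) (Ar _)).
- exact: (lin_comp (lin_comp (pl m) (Ar b)) (Ar a)).
move: a; apply: (graded_linear_ext grA) => [||g a Da].
- exact: (lin_comp (ml b) (Al _)).
- exact: Al.
move: b; apply: (graded_linear_ext grA) => [||g' b Db].
- exact: (lin_comp (mr a) (Al _)).
- exact: (lin_comp (Al _) (Ar a)).
have Dab := colour_algebraM (comodule_algebra_algebra A_comod) Da Db.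
rewrite (actTE _ Dab Dx) (actTE _ Db Dx) (linZ (Ar a)) (actTE _ Da Dx).
by rewrite scalerA (bicharDl beta_bichar) mulrC (moduleM M_module).
Qed.

(** The Hopf module compatibility without homogeneous expansions: the factor (|a_(0)|/|m_(-1)|) is
    exactly the one that [actT] produces when a_(0) passes m_(-1). *)
Lemma coaction_act a m :
  chiM (act a m) = tlift (fun x b => mulT x (actT b (chiM m))) (chiA a).
Proof.
have [s sP] := hexp_exists (chiA a) grH grA.
have [s' sP'] := hexp_exists (chiM m) grH grM.
rewrite (hopf_module_compat M_hopf sP sP') /hprod.
case: sP => Ds ->; case: sP' => Ds' ->.
have [mr _] := mulT_bil; have [Ar Al] := actT_bil.
rewrite tlift_sum; last first.
  split=> [x | b]; last exact: mulT_bil.2.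
  exact: (lin_comp (Al _) (mr x)).
rewrite [LHS]big_seq [RHS]big_seq; apply: eq_bigr => x xs.
rewrite (lin_sum (lin_comp (Ar _) (mr _))) [LHS]big_seq [RHS]big_seq.
apply: eq_bigr => y ys.
by rewrite (actTE _ (Ds x xs).2 (Ds' y ys).1) (linZ (mr _)) mulT_tpure.
Qed.

Lemma coaction_act_theta h m :
  chiM (act (theta h) m) =
  tlift (fun x y => mulT x (actT (theta y) (chiM m))) (Delta h).
Proof.
have [mr ml] := mulT_bil; have [Ar Al] := actT_bil.
have bil : bilinear_map (fun x b => mulT x (actT b (chiM m))).
  by split=> [x | b]; [apply: (lin_comp (Al _) (mr x)) | apply: ml].
rewrite coaction_act (colinear_comm theta_colinear) /tmap.
rewrite (lin_tlift (tlift_linear bil)).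
by apply: eq_tlift => x y; rewrite tlift_tpure.
Qed.

(** The two sides, [P] and [Q], agree after convolving with [b] and then [mulT]. Both operations
    have left inverses, built from [phi] and [S], and are cancelled outermost first. *)
Lemma coaction_hopf_proj m : chiM (p m) = one (p m).
Proof.
have [mr ml] := mulT_bil; have [Ar Al] := actT_bil.
have [pr pl] := @tpure_bilinear k H M.
have coassoc := comodule_coassoc M_comodule.
have counit := comodule_counit M_comodule.
have actT_theta_bil : bilinear_map (fun h => actT (theta h)).
  exact: (bilinear_comp actT_bil (linearP theta) (@linear_idfun _ _)).
have actT_phi_bil : bilinear_map (fun h => actT (phi h)).
  exact: (bilinear_comp actT_theta_bil (linearP S) (@linear_idfun _ _)).
have mulT_S_bil : bilinear_map (fun h => mulT (S h)).
  exact: (bilinear_comp mulT_bil (linearP S) (@linear_idfun _ _)).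
have cancel_mulT h z :
    tlift (fun x y => mulT (S x) (mulT y z)) (Delta h) = (eps h : k) *: z.
  have mulTM x y : mulT x (mulT y z) = mulT (amul x y) z.
    move: z; apply: tens_linear_ext => [||w n].
    - exact: (lin_comp (mr y) (mr x)).
    - exact: mr.
    - by rewrite !mulT_tpure amulA.
  have mulT1 : mulT (aone H) z = z.
    move: z {mulTM}; apply: tens_linear_ext => [||w n].
    - exact: mr.
    - exact: linear_idfun.
    - by rewrite mulT_tpure amul1l.
  rewrite (eq_tlift (g := fun x y => mulT (amul (S x) y) z)) //.
  by rewrite -(lin_tlift (ml z)) (hopf_S_left H_hopf) (linZ (ml z)) mulT1.
have cancel_actT h z :
    tlift (fun x y => actT (phi x) (actT (theta y) z)) (Delta h)
    = (eps h : k) *: z.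
  pose L x := actT (theta x) z; have lL : linear L by apply: actT_theta_bil.2.
  rewrite (eq_tlift (g := fun x y => L (amul (S x) y))) => [|x y].
    rewrite -(lin_tlift lL) (hopf_S_left H_hopf) (linZ lL) /L.
    by rewrite (colour_hom1 theta_hom) actT1.
  by rewrite /L (colour_homM theta_hom) actTM.
have lp := hopf_proj_linear.
pose P m := chiM (p m); pose Q m := one (p m).
have lP : linear P by apply: (lin_comp lp (linearP chiM)).
have lQ : linear Q by apply: (lin_comp lp (pr _)).
pose b h := actT (theta h).
(* The coaction applied to n = theta(n_(-1)) p(n_(0)). *)
have convP n : conv (chi := chiM) mulT (conv (chi := chiM) b P) n = chiM n.
  rewrite -(conv_coassoc coassoc) // -[in RHS](theta_hopf_proj n).
  rewrite (lin_tlift (linearP chiM)); apply: eq_tlift => h n'.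
  by rewrite coaction_act_theta.
have convQ n : conv (chi := chiM) b Q n = one n.
  rewrite -[in RHS](theta_hopf_proj n) (lin_tlift (pr _)).
  by apply: eq_tlift => h n'; apply: actT_one.
(* Convolving [one] with [mulT] also gives [chiM], since h (1 (x) n) = h (x) n; hence [mulT] can be
   cancelled. *)
have convP' n : conv (chi := chiM) b P n = one n.
  have lb : linear (conv (chi := chiM) b P) by apply: conv_linear.
  rewrite -[LHS](conv_cancel coassoc counit
    n mulT_bil mulT_S_bil lb cancel_mulT).
  rewrite -[RHS](conv_cancel coassoc counit
    n mulT_bil mulT_S_bil (pr _) cancel_mulT).
  apply: eq_tlift => h n'; rewrite convP -[in LHS](tens_id (chiM n')).
  by congr mulT; apply: eq_tlift => x y; rewrite mulT_tpure amul1r.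
rewrite -[LHS](conv_cancel coassoc counit
    m actT_theta_bil actT_phi_bil lP cancel_actT).
rewrite -[RHS](conv_cancel coassoc counit
    m actT_theta_bil actT_phi_bil lQ cancel_actT).
by apply: eq_tlift => h n; rewrite convP' convQ.
Qed.

End TwistedAction.

(** * The induced action on coinvariants *)

Lemma hopf_proj_coinv m : p m \in coinv chiM.
Proof.
have [actT [actT_bil actTE]] := twisted_action beta grA grH act_bil.
by rewrite inE; apply/eqP; apply: (coaction_hopf_proj actT_bil).
Qed.

(** For coinvariant [n] the coaction sends theta(h) n to h_1 (x) theta(h_2) n, so [phi_theta]
    applies. *)
Lemma hopf_proj_theta_coinv h n :
  n \in coinv chiM -> p (act (theta h) n) = eps h *: n.
Proof.
rewrite inE => /eqP nE.
have [actT [actT_bil actTE]] := twisted_action beta grA grH act_bil.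
rewrite /hopf_proj (coaction_act_theta actT_bil) // nE.
rewrite (lin_tlift (tlift_linear act_phi_bil)) -phi_theta.
apply: eq_tlift => x y.
by rewrite (actT_one actT_bil) // mulT_tpure amul1r tlift_tpure.
Qed.

(** Reduces to the coinvariant case through m = theta(m_(-1)) p(m_(0)), as [theta] and [eps] are
    multiplicative. *)
Lemma hopf_proj_theta h m : p (act (theta h) m) = eps h *: p m.
Proof.
have lp := hopf_proj_linear; have [ar _] := act_bil.
rewrite -{1}(theta_hopf_proj m) (lin_tlift (ar _)) (lin_tlift lp).
rewrite -[in RHS](comodule_counit M_comodule m) (lin_tlift lp).
have scale_linear : linear (fun z : M => eps h *: z).
  by move=> c u v; rewrite scalerDr !scalerA mulrC.
rewrite [RHS](lin_tlift scale_linear).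
apply: eq_tlift => x n.
rewrite -(moduleM M_module) -(colour_homM theta_hom).
rewrite hopf_proj_theta_coinv ?hopf_proj_coinv // (hopf_epsM H_hopf).
by rewrite (linZ lp) scalerA.
Qed.

(* The colour sign from commuting [a] past [theta h] is harmless: [eps h = 0]
   unless [h] has degree [0]. *)
Lemma hopf_proj_act_theta a h n :
  p (act a (act (theta h) n)) = eps h *: p (act a n).
Proof.
have lp := hopf_proj_linear; have [ar al] := act_bil.
have scale_linear c : linear (fun z : M => c *: z).
  by move=> d u v; rewrite scalerDr !scalerA mulrC.
move: a; apply: (graded_linear_ext grA) => [||g a Da].
- exact: (lin_comp (al _) lp).
- exact: (lin_comp (lin_comp (al n) lp) (scale_linear _)).
move: h; apply: (graded_linear_ext grH) => [||h x Dx].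
- exact: (lin_comp (act_theta_bil.2 n) (lin_comp (ar a) lp)).
- by move=> c u v; rewrite linearP scalerDl scalerA.
rewrite -(moduleM M_module) (A_comm Da (colour_hom_graded theta_hom Dx)).
rewrite (linZ (al n)) (linZ lp) (moduleM M_module) hopf_proj_theta.
have [-> | ->] := hopf_eps_graded H_hopf Dx.
  by rewrite bicharacter0r scale1r.
by rewrite !scale0r scaler0.
Qed.

Lemma hopf_proj_act_proj a m : p (act a (p m)) = p (act a m).
Proof.
have lp := hopf_proj_linear; have [ar _] := act_bil.
rewrite -[in RHS](theta_hopf_proj m) (lin_tlift (ar _)) (lin_tlift lp).
(* The left side is expanded by the counit and the right by [theta_hopf_proj]; both then run over
   [chiM m] and agree termwise, with value eps(h) p(a p(n)). *)
rewrite -{1}(comodule_counit M_comodule m) (lin_tlift lp) (lin_tlift (ar _)).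
rewrite (lin_tlift lp); apply: eq_tlift => h n.
by rewrite hopf_proj_act_theta (linZ lp) (linZ (ar _)) (linZ lp).
Qed.

Lemma coinvariants_graded_module :
  exists rharp : A -> coinvariants chiM -> coinvariants chiM,
    (forall (a : A) (m : coinvariants chiM),
       val (rharp a m) = p (act a (val m))) /\
    is_graded_module degA
      (fun g (m : coinvariants chiM) => degM g (val m)) rharp.
Proof.
have lp := hopf_proj_linear; have [ar al] := act_bil.
pose pr m : coinvariants chiM := Sub (p m) (hopf_proj_coinv m).
have val_pr m : val (pr m) = p m by rewrite SubK.
have prK (m : coinvariants chiM) : p (val m) = val m.
  exact/hopf_proj_coinv_id/valP.
exists (fun a m => pr (act a (val m))); split=> [a m|]; first exact: val_pr.
split=> [||m|a b m|g h a m Da Dm].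
- split=> [g | g c u v Du Dv | v | s f us Df f0 g gs].
  + by rewrite linear0; apply: (grading0 grM).
  + by rewrite linearP; apply: (grading_lin grM).
  + have [s [f [Df vE]]] := grading_span grM (val v).
    (* Components of a coinvariant taken in [M] are projected by the graded map [p]; their sum is
       unchanged because [p] fixes coinvariants. *)
    exists s, (fun g => pr (f g)); split=> [g | ].
      by rewrite val_pr; apply: hopf_proj_graded.
    apply: val_inj; rewrite -prK vE (lin_sum lp) linear_sum.
    by apply: eq_bigr => g _; rewrite -val_pr.
  + apply: val_inj; rewrite linear0.
    apply: (grading_indep grM us Df _ gs).
    by rewrite -linear_sum f0 linear0.
- split=> [a c u v | m c a b]; apply: val_inj; rewrite [RHS]linearP val_pr.
    by rewrite linearP ar lp -!val_pr.
  by rewrite al lp -!val_pr.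
- by apply: val_inj; rewrite val_pr (module1 M_module) prK.
- by apply: val_inj; rewrite !val_pr (moduleM M_module) hopf_proj_act_proj.
- by rewrite val_pr; apply: hopf_proj_graded; apply: (module_graded M_module).
Qed.

End HopfProjection.

(** Gives the statement about coinvariants of [A] as the case M = A. *)
Lemma comodule_algebra_hopf_module (k : fieldType) (G : zmodType)
    (beta : G -> G -> k) (H : ualgebra k) (degH : G -> H -> Prop)
    (Delta : {linear H -> tens H H}) (eps : {linear H -> k^o})
    (A : ualgebra k) (degA : G -> A -> Prop) (chiA : {linear A -> tens H A}) :
  is_comodule_colour_algebra beta degH Delta eps degA chiA ->
  is_colour_hopf_module beta degH Delta eps degA chiA degA chiA amul.
Proof.
case=> [[grA _ gradedM]] comod _ compat; split=> //.
split=> //; [exact: amul_bilinear | exact: amul1l | ].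
by move=> a b c; rewrite amulA.
Qed.

Theorem proposition3p21
  (k : fieldType) (G : zmodType) (beta : G -> G -> k)
  (beta_bichar : is_bicharacter beta)
  (H : ualgebra k) (degH : G -> H -> Prop)
  (Delta : {linear H -> tens H H}) (eps : {linear H -> k^o})
  (S : {linear H -> H})
  (H_hopf : is_colour_hopf_algebra beta degH Delta eps S)
  (A : ualgebra k) (degA : G -> A -> Prop) (chiA : {linear A -> tens H A})
  (A_comod : is_comodule_colour_algebra beta degH Delta eps degA chiA)
  (A_comm : colour_commutative beta degA)
  (M : lmodType k) (degM : G -> M -> Prop) (chiM : {linear M -> tens H M})
  (act : A -> M -> M)
  (M_hopf : is_colour_hopf_module beta degH Delta eps degA chiA degM chiM act)
  (theta : {linear H -> A})
  (theta_colinear : is_graded_colinear degH Delta degA chiA theta)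
  (theta_hom : is_colour_algebra_hom degH degA theta)
  (beta_sym : symmetric_bicharacter beta) :
  let pM := hopf_proj S theta act chiM in
  let pA := hopf_proj S theta amul chiA in
  let rharpM (a : A) (m : M) := pM (act a m) in
  let rharpA (a' a : A) := pA (amul a' a) in
  [/\ (forall (a : A) (m : M),
         rharpM a (pM m) = pM (act a m) /\ pM (act a m) = rharpM a m),
      (exists rharp : A -> coinvariants chiM -> coinvariants chiM,
         (forall (a : A) (m : coinvariants chiM),
            val (rharp a m) = rharpM a (val m)) /\
         is_graded_module degA
           (fun g (m : coinvariants chiM) => degM g (val m)) rharp)
    & (exists rharp : A -> coinvariants chiA -> coinvariants chiA,
         (forall (a' : A) (a : coinvariants chiA),
            val (rharp a' a) = rharpA a' (val a)) /\
         is_graded_module degA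
           (fun g (a : coinvariants chiA) => degA g (val a)) rharp)].
Proof.
move=> pM pA rharpM rharpA; split.
- move=> a m; split=> //.
  exact: (hopf_proj_act_proj beta_bichar H_hopf A_comod A_comm M_hopf
    theta_colinear).
- exact: (coinvariants_graded_module beta_bichar H_hopf A_comod A_comm M_hopf).
- exact: (coinvariants_graded_module beta_bichar H_hopf A_comod A_comm
    (comodule_algebra_hopf_module A_comod)).
Qed.
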